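(* Let $\mathcal X,\mathcal Y$ be finite sets, $\pi$ a probability distribution on $\mathcal X$, and $K:\mathcal X\to\mathcal Y$ a Markov kernel. Then at least one of the following holds: (i) $\eta_{\mathrm{KL}}(\pi,K)=\eta_{\chi^2}(\pi,K)$; (ii) there exists a probability distribution $\nu$ on $\mathcal X$ with $0<D(\nu\|\pi)<\infty$ such that $\eta_{\mathrm{KL}}(\pi,K)=\frac{D(\nu K\|\pi K)}{D(\nu\|\pi)}$.
   Context: A Markov kernel $K:\mathcal X\to\mathcal Y$ is a nonnegative matrix $(K(x,y))$ with rows summing to $1$; $(\nu K)(y)=\sum_x\nu(x)K(x,y)$. For probability distributions $\nu,\pi$: $D(\nu\|\pi)=\sum_x\nu(x)\log\frac{\nu(x)}{\pi(x)}$ (KL divergence) and $\chi^2(\nu\|\pi)=\sum_{x:\pi(x)>0}\frac{(\nu(x)-\pi(x))^2}{\pi(x)}$, both $+\infty$ if $\nu\not\ll\pi$. The contraction coefficients are $$\eta_{\mathrm{KL}}(\pi,K)=\sup_{\nu:\,0<D(\nu\|\pi)<\infty}\frac{D(\nu K\|\pi K)}{D(\nu\|\pi)},\qquad \eta_{\chi^2}(\pi,K)=\sup_{\nu:\,0<\chi^2(\nu\|\pi)<\infty}\frac{\chi^2(\nu K\|\pi K)}{\chi^2(\nu\|\pi)},$$ with $\nu$ ranging over probability distributions on $\mathcal X$. (If $\pi$ is a point mass no such $\nu$ exists and both suprema are taken to be $0$.) *)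

(* Defs.v *)
From HB Require Import structures.
From mathcomp Require Import all_boot all_order all_algebra.
From mathcomp Require Import all_classical all_reals all_analysis.
Set Implicit Arguments.
Unset Strict Implicit.
Unset Printing Implicit Defensive.
Import Order.TTheory GRing.Theory Num.Theory.
Local Open Scope classical_set_scope.
Local Open Scope ring_scope.

Definition is_dist (R : realType) (T : finType) (p : T -> R) : Prop :=
  (forall x, 0 <= p x) /\ \sum_x p x = 1.

Definition is_kernel (R : realType) (X Y : finType) (K : X -> Y -> R) : Prop :=
  forall x, is_dist (K x).

Definition push (R : realType) (X Y : finType) (nu : X -> R) (K : X -> Y -> R)
  : Y -> R := fun y => \sum_x nu x * K x y.

Definition abs_cont (R : realType) (T : finType) (nu pi : T -> R) : bool :=
  [forall x, (pi x == 0) ==> (nu x == 0)].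

(* Terms with nu x = 0 vanish, which is the convention 0 log 0 = 0. *)
Definition KL (R : realType) (T : finType) (nu pi : T -> R) : \bar R :=
  if abs_cont nu pi then (\sum_x nu x * ln (nu x / pi x))%:E else +oo%E.

Definition chi2 (R : realType) (T : finType) (nu pi : T -> R) : \bar R :=
  if abs_cont nu pi
  then (\sum_(x | (0 < pi x)%R) (nu x - pi x) ^+ 2 / pi x)%:E else +oo%E.

(* The supremum of the empty set is 0 by convention, whereas ereal_sup gives
   -oo there. *)
Definition sup_or0 (R : realType) (S : set (\bar R)) : \bar R :=
  if S == set0 then 0%E else ereal_sup S.

Definition eta_KL (R : realType) (X Y : finType) (pi : X -> R)
    (K : X -> Y -> R) : \bar R :=
  sup_or0 [set (KL (push nu K) (push pi K) / KL nu pi)%E | nu in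
    [set nu : X -> R | is_dist nu /\ (0 < KL nu pi < +oo)%E]].

Definition eta_chi2 (R : realType) (X Y : finType) (pi : X -> R)
    (K : X -> Y -> R) : \bar R :=
  sup_or0 [set (chi2 (push nu K) (push pi K) / chi2 nu pi)%E | nu in
    [set nu : X -> R | is_dist nu /\ (0 < chi2 nu pi < +oo)%E]].

(* Main.v *)
(** When [|nu - pi| <= e pi] pointwise, Taylor expansion of [t ln t] at [1]
    pins the KL divergence between [chi2 / (2 (1 + e))] and
    [chi2 / (2 (1 - e))], and this closeness is inherited by the pushed-forward
    distributions; hence near [pi] the KL ratio and the chi-squared ratio agree
    up to a factor [(1 + e) / (1 - e)].  Moving [nu] towards [pi] along a
    segment does not change its chi-squared ratio, so [eta_chi2 <= eta_KL]
    always holds.  If the inequality is strict, distributions close to [pi] stay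
    strictly below [eta_KL], so the supremum is that of a continuous function on
    the compact set of distributions that are absolutely continuous and bounded
    away from [pi], where it is attained. *)

Require Import Defs.
From mathcomp Require Import all_boot all_order all_algebra.
From mathcomp Require Import all_classical all_reals all_analysis.
From mathcomp Require Import ring lra.
Set Implicit Arguments.
Unset Strict Implicit.
Unset Printing Implicit Defensive.
Import Order.TTheory GRing.Theory Num.Theory.
Import numFieldNormedType.Exports.
Local Open Scope classical_set_scope.
Local Open Scope ring_scope.

(** * Scalar estimates for [ln] and [t * ln t] *)

Section real_inequalities.
Variable R : realType.
Implicit Types c e p s t x : R.

Lemma ln_lt_subr1 x : 0 < x -> x != 1 -> ln x < x - 1.
Proof.
move=> x0 x1; have: ln x != 0 by rewrite ln_eq0.
by move=> /expR_gt1Dx; rewrite lnK ?posrE// addrC ltrBrDr.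
Qed.

Lemma ln_le_subr1 x : 0 < x -> ln x <= x - 1.
Proof.
by move=> x0; have [->|/(ln_lt_subr1 x0)/ltW//] := eqVneq x 1; rewrite ln1 subrr.
Qed.

Lemma ln_ge_1subV x : 0 < x -> 1 - x^-1 <= ln x.
Proof.
move=> x0; have := @ln_le_subr1 x^-1; rewrite invr_gt0 => /(_ x0).
by rewrite lnV ?posrE// lerNl opprB.
Qed.

(** Mean value theorem between [1] and [t] for the left-hand side as a function of [t]: it vanishes
    at [1] and has derivative [ln s - c * (s - 1)]. Leaving [c] free serves both quadratic
    bounds. *)
Lemma MVT_xlnx c t : 0 < t -> exists2 s,
  t <= s <= 1 \/ 1 <= s <= t &
  t * ln t - t + 1 - c / 2 * (t - 1) ^+ 2 = (ln s - c * (s - 1)) * (t - 1).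
Proof.
move=> t0; pose f s := s * ln s - s + 1 - c / 2 * (s - 1) ^+ 2.
have df s : 0 < s -> is_derive s 1 f (ln s - c * (s - 1)).
  move=> s0; have lns := is_derive1_ln s0.
  apply: is_derive_eq; rewrite /GRing.scale/= !(mulr1, mulr0, addr0, add0r, oppr0).
  have : s * s^-1 = 1 by rewrite divff// gt_eqF.
  by lra.
have f1 : f 1 = 0 by rewrite /f ln1; lra.
have cf a b : 0 < a -> {within `[a, b], continuous f}.
  move=> a0; apply: derivable_within_continuous => z; rewrite in_itv/= => /andP[az _].
  by have [] := df z (lt_le_trans a0 az).
have [t1|t1|->] := ltgtP t 1.
- have dt z : z \in `]t, 1[ -> is_derive z 1 f (ln z - c * (z - 1)).
    by rewrite in_itv/= => /andP[tz _]; exact/df/(lt_trans t0).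
  have [z] := MVT t1 dt (cf _ _ t0).
  rewrite in_itv/= f1 => /andP[/ltW tz /ltW z1] fz.
  by exists z; [left; rewrite tz|rewrite -/(f t); lra].
- have dt z : z \in `]1, t[ -> is_derive z 1 f (ln z - c * (z - 1)).
    by rewrite in_itv/= => /andP[tz _]; exact/df/(lt_trans ltr01).
  have [z] := MVT t1 dt (cf _ _ ltr01).
  rewrite in_itv/= f1 => /andP[/ltW tz /ltW z1] fz.
  by exists z; [right; rewrite tz|rewrite -/(f t); lra].
- by exists 1; [left; rewrite lexx|rewrite ln1; lra].
Qed.

(** The second derivative [1 / s] of [s ln s] lies between [1 / (1 + e)] and [1 / (1 - e)] on the
    interval. With these values of [c], the bounds [1 - 1 / s <= ln s <= s - 1] fix the sign of the
    remainder on each side of [1]. *)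
Lemma xlnx_quadratic e t : 0 < e < 1 -> `|t - 1| <= e ->
  (t - 1) ^+ 2 / (2 * (1 + e)) <= t * ln t - t + 1 <= (t - 1) ^+ 2 / (2 * (1 - e)).
Proof.
move=> /andP[e0 e1]; rewrite ler_norml => /andP[te1 te2].
have t0 : 0 < t by lra.
have slope s : t <= s <= 1 \/ 1 <= s <= t ->
  0 <= (ln s - (1 + e)^-1 * (s - 1)) * (t - 1) /\
  (ln s - (1 - e)^-1 * (s - 1)) * (t - 1) <= 0.
  move=> ts; have s0 : 0 < s by case: ts => /andP[? ?]; lra.
  have l1 := ln_le_subr1 s0; have l2 := ln_ge_1subV s0.
  have i1 : (1 + e)^-1 * (1 + e) = 1 by rewrite mulVf//; apply/eqP; lra.
  have i2 : (1 - e)^-1 * (1 - e) = 1 by rewrite mulVf//; apply/eqP; lra.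
  have i3 : s^-1 * s = 1 by rewrite mulVf//; apply/eqP; lra.
  have j1 : 0 < (1 + e)^-1 by rewrite invr_gt0; lra.
  have j2 : 0 < (1 - e)^-1 by rewrite invr_gt0; lra.
  have j3 : 0 < s^-1 by rewrite invr_gt0; lra.
  move: i1 i2 i3 j1 j2 j3 l2.
  set a := (1 + e)^-1; set b := (1 - e)^-1; set d := s^-1 => i1 i2 i3 j1 j2 j3 l2.
  have [[/andP[ts1 s1]]|[/andP[s1 st]]] := ts; split.
  - apply: mulr_le0; last lra.
    have : a <= 1 by nra.
    by nra.
  - apply: mulr_ge0_le0; last lra.
    have : d <= b by nra.
    by nra.
  - apply: mulr_ge0; last lra.
    have : a <= d by nra.
    by nra.
  - apply: mulr_le0_ge0; last lra.
    have : 1 <= b by nra.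
    by nra.
have [s1 /slope[l1 _] E1] := MVT_xlnx (1 + e)^-1 t0.
have [s2 /slope[_ l2] E2] := MVT_xlnx (1 - e)^-1 t0.
rewrite !invfM; apply/andP; split; lra.
Qed.

(** For [x > 0] this is [ln y < y - 1] at [y = p / x], multiplied by [x]. Strictness is what makes
    the divergence positive away from [pi]. *)
Lemma gibbs_term_lt x p : 0 <= x -> 0 < p -> x != p -> x - p < x * ln (x / p).
Proof.
move=> x0 p0 xp; move: x0; rewrite le_eqVlt => /predU1P[<-|x0].
  by rewrite mul0r sub0r oppr_lt0.
have q0 : 0 < p / x by rewrite divr_gt0.
have q1 : p / x != 1.
  by apply: contra xp => /eqP h; rewrite eq_sym -(divfK (lt0r_neq0 x0) p) h mul1r.
rewrite -[x / p]invf_div lnV ?posrE// mulrN ltrNr opprB.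
have {2}-> : p = x * (p / x) by rewrite mulrC divfK// gt_eqF.
by rewrite -[X in _ - X]mulr1 -mulrBr ltr_pM2l// ln_lt_subr1.
Qed.

(** With [r = Num.sqrt t] positive, [t ln t = 2 r^2 ln r >= 2 r^2 (1 - 1 / r) >= - 2 r]. This gives
    the squeeze at [0]. *)
Lemma xlnx_sqrt_bounds t : t <= 1 -> - (2 * Num.sqrt t) <= t * ln t <= 0.
Proof.
move=> t1; have [t0|t0] := leP t 0; first by rewrite ln0// mulr0 ler0_sqrtr// mulr0 oppr0 lexx.
have s0 : 0 < Num.sqrt t by rewrite sqrtr_gt0.
have tE : t = Num.sqrt t ^+ 2 by rewrite sqr_sqrtr// ltW.
rewrite pmulr_rle0// ln_le0// andbT {2 3}tE lnXn//.
have := ln_ge_1subV s0; have : Num.sqrt t * (Num.sqrt t)^-1 = 1 by rewrite divff// gt_eqF.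
by nra.
Qed.

(* For [t <= 0] the function vanishes, since [ln] is [0] there. *)
Lemma continuous_xlnx p : 0 <= p -> continuous (fun t : R => t * ln (t / p)).
Proof.
rewrite le_eqVlt => /predU1P[<-|p0] t.
  (* For [p = 0] the quotient is [0] by convention, and so is its [ln]. *)
  rewrite (_ : (fun _ => _) = cst 0); first exact: cst_continuous.
  by apply/funext => s; rewrite invr0 mulr0 ln0// mulr0.
have dp : {for t, continuous (fun t => t / p)}.
  by apply: cvgMr_tmp; exact: cvg_id.
have [t0|t0] := ltP 0 t.
  apply: cvgM; first exact: cvg_id.
  apply: (@continuous_comp _ _ _ (fun t => t / p) (@ln R)) => //.
  by apply: continuous_ln; rewrite divr_gt0.
have tp0 : t / p <= 0 by rewrite pmulr_lle0 ?invr_gt0.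
rewrite /continuous_at ln0// mulr0.
apply: (@squeeze_cvgr _ _ _ _ (fun s => - (2 * p) * Num.sqrt (s / p)) (cst 0)).
- near=> s; have sp : s <= p by near: s; apply: filterS (lt_nbhsl (le_lt_trans t0 p0)) => ? /ltW.
  have := @xlnx_sqrt_bounds (s / p); rewrite ler_pdivrMr// mul1r => /(_ sp)/andP[h1 h2].
  have E : s * ln (s / p) = p * (s / p * ln (s / p)) by rewrite mulrA [p * _]mulrC divfK ?gt_eqF.
  apply/andP; split; last by rewrite E pmulr_rle0.
  by rewrite E; nra.
- rewrite -[X in _ --> X](mulr0 (- (2 * p))); apply: cvgMl_tmp.
  have cs : Num.sqrt (s / p) @[s --> t] --> Num.sqrt (t / p).
    apply: (@continuous_comp _ _ _ (fun s => s / p) (@Num.sqrt R)) => //.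
    exact: sqrt_continuous.
  by rewrite (ler0_sqrtr tp0) in cs.
- exact: cvg_cst.
Unshelve. all: by end_near.
Qed.

Lemma exists_factor_gap s c : 0 <= s < c ->
  exists2 e, 0 < e < 1 & s * (1 + e) <= c * (1 - e).
Proof.
move=> /andP[s0 sc]; have d0 : 0 < 2 * (c + s) by lra.
(* Equality would hold at [(c - s) / (c + s)]; halving keeps [e < 1] even when [s = 0]. *)
exists ((c - s) / (2 * (c + s))).
  by rewrite divr_gt0//= ?ltr_pdivrMr//; lra.
have : (c - s) / (2 * (c + s)) * (2 * (c + s)) = c - s by rewrite divfK// gt_eqF.
by lra.
Qed.

End real_inequalities.

(** * Real-valued divergences and their behaviour near [pi] *)

Section divergences.
Variables (R : realType) (T : finType).
Implicit Types nu pi : T -> R.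

Definition klr nu pi : R := \sum_x nu x * ln (nu x / pi x).

Definition chi2r nu pi : R := \sum_(x | 0 < pi x) (nu x - pi x) ^+ 2 / pi x.

(** A sum rather than a maximum: it still dominates every relative deviation, and it is continuous
    as a finite sum. *)
Definition rel_dist nu pi : R := \sum_(x | 0 < pi x) `|nu x - pi x| / pi x.

Lemma abs_contP nu pi :
  reflect (forall x, pi x = 0 -> nu x = 0) (abs_cont nu pi).
Proof.
apply: (iffP forallP) => h x; first by move=> /eqP p0; apply/eqP/(implyP (h x)).
by apply/implyP => /eqP/h ->.
Qed.

Lemma KLE nu pi : abs_cont nu pi -> KL nu pi = (klr nu pi)%:E.
Proof. by rewrite /KL => ->. Qed.

Lemma chi2E nu pi : abs_cont nu pi -> chi2 nu pi = (chi2r nu pi)%:E.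
Proof. by rewrite /chi2 => ->. Qed.

(** The added terms cancel because both masses are [1]; under absolute continuity they make every
    summand nonnegative. *)
Lemma klr_sumE nu pi : is_dist nu -> is_dist pi ->
  klr nu pi = \sum_x (nu x * ln (nu x / pi x) - nu x + pi x).
Proof. by move=> [_ n1] [_ p1]; rewrite big_split sumrB/= n1 p1 subrK. Qed.

Lemma gibbs_term_ge0 nu pi x : is_dist nu -> is_dist pi -> abs_cont nu pi ->
  0 <= nu x * ln (nu x / pi x) - nu x + pi x.
Proof.
move=> [n0 _] [p0 _] /abs_contP ac.
have [px|px] := eqVneq (pi x) 0; first by rewrite ac// px mul0r subrr addr0.
have {}px : 0 < pi x by rewrite lt0r px p0.
have [->|np] := eqVneq (nu x) (pi x); first by rewrite divff ?gt_eqF// ln1 mulr0 sub0r addNr.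
by have := gibbs_term_lt (n0 x) px np; lra.
Qed.

Lemma klr_ge0 nu pi : is_dist nu -> is_dist pi -> abs_cont nu pi ->
  0 <= klr nu pi.
Proof.
by move=> dn dp ac; rewrite klr_sumE// sumr_ge0// => x _; exact: gibbs_term_ge0.
Qed.

Lemma neq_support nu pi : is_dist pi -> abs_cont nu pi -> nu <> pi ->
  exists2 x, 0 < pi x & nu x != pi x.
Proof.
move=> [p0 _] /abs_contP ac npi.
have /existsNP[x /eqP nx] : ~ forall x, nu x = pi x by move/funext.
exists x => //; rewrite lt0r p0 andbT.
by apply: contra nx => /eqP px; rewrite px ac.
Qed.

Lemma klr_gt0 nu pi : is_dist nu -> is_dist pi -> abs_cont nu pi ->
  nu <> pi -> 0 < klr nu pi.
Proof.
move=> dn dp ac /(neq_support dp ac)[x px nx].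
rewrite klr_sumE// (bigD1 x)//= ltr_pwDl//; last first.
  by rewrite sumr_ge0// => y _; exact: gibbs_term_ge0.
by case: dn => n0 _; have := gibbs_term_lt (n0 x) px nx; lra.
Qed.

Lemma chi2r_ge0 nu pi : 0 <= chi2r nu pi.
Proof. by apply: sumr_ge0 => x px; rewrite divr_ge0 ?sqr_ge0// ltW. Qed.

Lemma chi2r_gt0 nu pi : is_dist pi -> abs_cont nu pi ->
  nu <> pi -> 0 < chi2r nu pi.
Proof.
move=> dp ac /(neq_support dp ac)[x px nx].
rewrite /chi2r (bigD1 x)//= ltr_pwDl//; last first.
  by rewrite sumr_ge0// => y /andP[py _]; rewrite divr_ge0 ?sqr_ge0// ltW.
by rewrite divr_gt0// exprn_even_gt0//= subr_eq0.
Qed.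

Lemma KL_gt0_lty nu pi : is_dist nu -> is_dist pi ->
  (0 < KL nu pi < +oo)%E <-> abs_cont nu pi /\ nu <> pi.
Proof.
move=> dn dp; split=> [|[ac np]]; last by rewrite KLE// lte_fin klr_gt0// ltry.
rewrite /KL; case: ifPn => [ac|]; last by rewrite ltxx andbF.
rewrite lte_fin => /andP[kp _]; split=> // np; move: kp.
rewrite np big1 ?ltxx// => x _; have [->|px] := eqVneq (pi x) 0; first by rewrite mul0r.
by rewrite divff// ln1 mulr0.
Qed.

Lemma chi2_gt0_lty nu pi : is_dist pi ->
  (0 < chi2 nu pi < +oo)%E <-> abs_cont nu pi /\ nu <> pi.
Proof.
move=> dp; split=> [|[ac np]]; last by rewrite chi2E// lte_fin chi2r_gt0// ltry.
rewrite /chi2; case: ifPn => [ac|]; last by rewrite ltxx andbF.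
rewrite lte_fin => /andP[kp _]; split=> // np; move: kp.
by rewrite np big1 ?ltxx// => x _; rewrite subrr expr0n mul0r.
Qed.

Lemma rel_dist_self pi : rel_dist pi pi = 0.
Proof. by apply: big1 => x _; rewrite subrr normr0 mul0r. Qed.

Lemma rel_dist_ge0 nu pi : 0 <= rel_dist nu pi.
Proof. by apply: sumr_ge0 => x px; rewrite divr_ge0// ltW. Qed.

Lemma ler_rel_dist nu pi x : is_dist pi -> abs_cont nu pi ->
  `|nu x - pi x| <= rel_dist nu pi * pi x.
Proof.
move=> [p0 _] /abs_contP ac.
have [px|px] := eqVneq (pi x) 0; first by rewrite ac// px subrr normr0 mulr0.
have {}px : 0 < pi x by rewrite lt0r px p0.
rewrite -ler_pdivrMr// /rel_dist (bigD1 x)//= lerDl sumr_ge0// => y /andP[py _].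
by rewrite divr_ge0// ltW.
Qed.

(** On the support, each summand is [pi x * (t ln t - t + 1)] with [t = nu x / pi x], so
    [xlnx_quadratic] applies termwise. Off the support, closeness forces [nu x = 0]. *)
Lemma klr_quadratic nu pi e : is_dist nu -> is_dist pi -> 0 < e < 1 ->
  (forall x, `|nu x - pi x| <= e * pi x) ->
  chi2r nu pi / (2 * (1 + e)) <= klr nu pi <= chi2r nu pi / (2 * (1 - e)).
Proof.
move=> dn dp e01 ne; rewrite klr_sumE// /chi2r !mulr_suml.
have nx0 x : pi x = 0 -> nu x = 0.
  by move=> px; have := ne x; rewrite px mulr0 subr0 normr_le0 => /eqP.
have -> : \sum_x (nu x * ln (nu x / pi x) - nu x + pi x) =
    \sum_(x | 0 < pi x) (nu x * ln (nu x / pi x) - nu x + pi x).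
  rewrite [RHS]big_mkcond; apply: eq_bigr => x _; case: ifPn => //.
  rewrite lt0r dp.1 andbT negbK => /eqP px.
  by rewrite nx0// px mul0r subrr addr0.
have B x : 0 < pi x ->
    (nu x - pi x) ^+ 2 / pi x / (2 * (1 + e)) <= nu x * ln (nu x / pi x) - nu x + pi x
    <= (nu x - pi x) ^+ 2 / pi x / (2 * (1 - e)).
  move=> px; have pn : pi x != 0 by rewrite gt_eqF.
  pose t := nu x / pi x; have nE : nu x = t * pi x by rewrite /t divfK.
  have te : `|t - 1| <= e.
    by have := ne x; rewrite nE -{2}[pi x]mul1r -mulrBl normrM (gtr0_norm px) ler_pM2r.
  have /andP[l u] := xlnx_quadratic e01 te.
  rewrite -/t nE.
  have -> : (t * pi x - pi x) ^+ 2 / pi x = pi x * (t - 1) ^+ 2 by field.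
  have -> : t * pi x * ln t - t * pi x + pi x = pi x * (t * ln t - t + 1) by ring.
  by apply/andP; split; rewrite -[pi x * _ * _]mulrA ler_pM2l.
by apply/andP; split; apply: ler_sum => x /B/andP[].
Qed.

End divergences.

(** * Stability under the kernel *)

Section push.
Variables (R : realType) (X Y : finType) (K : X -> Y -> R).
Hypothesis hK : is_kernel K.
Implicit Types nu pi : X -> R.

Lemma push_dist nu : is_dist nu -> is_dist (push nu K).
Proof.
move=> [n0 n1]; split=> [y|]; first by apply: sumr_ge0 => x _; rewrite mulr_ge0// (hK x).1.
rewrite /push exchange_big/= -n1; apply: eq_bigr => x _.
by rewrite -mulr_sumr (hK x).2 mulr1.
Qed.

Lemma push_abs_cont nu pi : is_dist pi -> abs_cont nu pi ->
  abs_cont (push nu K) (push pi K).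
Proof.
move=> [p0 _] /abs_contP ac; apply/abs_contP => y.
rewrite /push => /psumr_eq0P pK; apply: big1 => x _.
have /eqP : pi x * K x y = 0 by apply: pK => // z _; rewrite mulr_ge0// (hK z).1.
by rewrite mulf_eq0 => /orP[/eqP/ac ->|/eqP ->]; rewrite ?mul0r ?mulr0.
Qed.

(** Triangle inequality with nonnegative weights [K x y]; the same [e] thus serves before and after
    the kernel. *)
Lemma push_close nu pi e : (forall x, `|nu x - pi x| <= e * pi x) ->
  forall y, `|push nu K y - push pi K y| <= e * push pi K y.
Proof.
move=> ne y; rewrite /push -sumrB mulr_sumr.
apply: le_trans (ler_norm_sum _ _ _) _; apply: ler_sum => x _.
have k0 := (hK x).1 y.
by rewrite -mulrBl normrM (ger0_norm k0) mulrA ler_wpM2r.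
Qed.

End push.

(** * Compactness and existence of a maximizer away from [pi] *)

Section maximizer.
Variables (R : realType) (X Y : finType) (pi : X -> R) (K : X -> Y -> R).
Hypotheses (hpi : is_dist pi) (hK : is_kernel K).

Import ArrowAsProduct.

Let PT : topologicalType := prod_topology (fun _ : X => R).

Let continuous_coord (x : X) : continuous (fun nu : PT => nu x : R).
Proof. exact: proj_continuous. Qed.

Let continuous_sumR (I : finType) (P : pred I) (F : I -> PT -> R) :
  (forall i, P i -> continuous (F i)) ->
  continuous (fun nu : PT => \sum_(i | P i) F i nu).
Proof. by move=> cF; apply: continuous_big => //; exact: add_continuous. Qed.

(** Extreme value theorem on [far]: staying away from [pi] makes the set closed and keeps the
    denominator nonzero. *)
Lemma klr_max_ratio (e : R) : 0 < e ->
  let far := [set nu | [/\ is_dist nu, abs_cont nu pi & e <= rel_dist nu pi]] in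
  far !=set0 -> exists2 nu, far nu & forall nu', far nu' ->
    klr (push nu' K) (push pi K) / klr nu' pi <=
    klr (push nu K) (push pi K) / klr nu pi.
Proof.
move=> e0 far far0.
have compf : compact (far : set PT).
  (* Collapsing the side to a point where [pi] vanishes encodes absolute continuity as a closed
     condition. *)
  pose box (x : X) : set R := `[0, (if pi x == 0 then 0 else 1) : R]%classic.
  have boxc : compact ([set nu | forall x, box x (nu x)] : set PT).
    by apply: (@tychonoff X (fun _ => R) box) => x; exact: segment_compact.
  have subbox : far `<=` [set nu | forall x, box x (nu x)].
    move=> nu [[n0 n1] /abs_contP ac _] x; rewrite /box/= in_itv/= n0/=.
    have [/ac ->//|_] := eqVneq (pi x) 0.
    by rewrite -n1 (bigD1 x)//= lerDl sumr_ge0.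
  apply: (subclosed_compact _ boxc subbox).
  have -> : far = [set nu | forall x, box x (nu x)] `&`
      ((fun nu : PT => \sum_x nu x) @^-1` [set 1] `&`
       (fun nu : PT => rel_dist nu pi) @^-1` [set s | e <= s]).
    apply/seteqP; split=> nu.
      by move=> fnu; split; [exact: subbox|case: fnu => [[]]].
    move=> [bnu [/= n1 nf]]; split=> //.
      by split=> // x; have := bnu x; rewrite /box/= in_itv/= => /andP[].
    apply/abs_contP => x px; have := bnu x; rewrite /box/= in_itv/= px eqxx => n0.
    by apply/eqP; rewrite eq_le andbC.
  apply: closedI.
    by apply: compact_closed boxc; apply: hausdorff_product => x; exact: Rhausdorff.
  apply: closedI; apply: preimage_closed => [nu _|]; [|exact: closed_eq| |exact: closed_ge].
    by apply: continuous_sumR => x _; exact: continuous_coord.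
  apply: continuous_sumR => x _ mu.
  apply: (@continuous_comp _ _ _ (fun nu : PT => nu x) (fun s : R => `|s - pi x| / pi x)).
    exact: continuous_coord.
  apply: cvgMr_tmp; apply: (@cvg_norm _ R^o); apply: (@cvgB _ R^o).
    exact: cvg_id.
  exact: cvg_cst.
pose ratio (nu : PT) : R := klr (push nu K) (push pi K) / klr nu pi.
have cratio : {within (far : set PT), continuous ratio}.
  apply: continuous_in_subspaceT => nu; rewrite inE => -[dn ac nf].
  have np : nu <> pi.
    by move=> np; move: nf; rewrite np rel_dist_self leNgt e0.
  (* Stated for a general family so as to cover both numerator and denominator; points of zero mass
     are handled by [continuous_xlnx]. *)
  have ck (Z : finType) (q : Z -> R) (F : PT -> Z -> R) : is_dist q ->
      (forall z, continuous (F^~ z)) -> continuous (fun mu => klr (F mu) q).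
    move=> [q0 _] cF; apply: continuous_sumR => z _ mu.
    apply: (@continuous_comp _ _ _ (F^~ z) (fun t => t * ln (t / q z))); first exact: cF.
    exact: continuous_xlnx.
  have cN : continuous (fun mu : PT => klr (push mu K) (push pi K)).
    apply: (ck _ _ (fun mu : PT => push mu K)); first exact: push_dist.
    move=> y; apply: continuous_sumR => x _ mu.
    apply: (@continuous_comp _ _ _ (fun nu : PT => nu x) (fun s : R => s * K x y)).
      exact: continuous_coord.
    by apply: cvgMr_tmp; exact: cvg_id.
  have cD : continuous (fun mu : PT => klr mu pi).
    by apply: (ck _ _ (fun mu : PT => mu)) => // x; exact: continuous_coord.
  apply: (@cvgM _ _ (nbhs nu) _ (fun mu : PT => klr (push mu K) (push pi K))
    (fun mu : PT => (klr mu pi)^-1) _ _ (cN nu)).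
  apply: (@cvgV _ _ (nbhs nu) _ (fun mu : PT => klr mu pi) _ _ (cD nu)).
  by rewrite gt_eqF// klr_gt0.
have [nu nuf numax] := compact_EVT_max far0 compf cratio.
exists nu; first by rewrite inE in nuf.
by move=> mu fmu; apply: numax; rewrite inE.
Qed.

End maximizer.

(** * Comparison of the two contraction ratios *)

Section contraction.
Variables (R : realType) (X Y : finType) (pi : X -> R) (K : X -> Y -> R).
Hypotheses (hpi : is_dist pi) (hK : is_kernel K).
Implicit Types nu : X -> R.

(** Common index set of both suprema: for either divergence, being positive and finite amounts to
    this. *)
Definition admissible := [set nu | [/\ is_dist nu, abs_cont nu pi & nu <> pi]].

Definition kl_ratio nu := klr (push nu K) (push pi K) / klr nu pi.

Definition chi2_ratio nu := chi2r (push nu K) (push pi K) / chi2r nu pi.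

Lemma kl_ratio_ge0 nu : admissible nu -> 0 <= kl_ratio nu.
Proof.
move=> [dn ac _]; rewrite /kl_ratio divr_ge0 ?klr_ge0//; first exact: push_dist.
- exact: push_dist.
- exact: push_abs_cont.
Qed.

Lemma KL_ratioE nu : admissible nu ->
  (KL (push nu K) (push pi K) / KL nu pi)%E = (kl_ratio nu)%:E.
Proof.
move=> [dn ac np]; rewrite !KLE//; last exact: push_abs_cont.
by rewrite inver gt_eqF ?klr_gt0.
Qed.

Lemma chi2_ratioE nu : admissible nu ->
  (chi2 (push nu K) (push pi K) / chi2 nu pi)%E = (chi2_ratio nu)%:E.
Proof.
move=> [dn ac np]; rewrite !chi2E//; last exact: push_abs_cont.
by rewrite inver gt_eqF ?chi2r_gt0.
Qed.

Lemma eta_KLE :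
  eta_KL pi K = sup_or0 [set (kl_ratio nu)%:E | nu in admissible].
Proof.
rewrite /eta_KL; congr sup_or0; apply/seteqP; split=> y [nu].
  by move=> [dn /(KL_gt0_lty dn hpi)[ac np]] <-; exists nu; rewrite ?KL_ratioE.
move=> adm <-; have [dn ac np] := adm.
by exists nu; [split=> //; apply/KL_gt0_lty|rewrite KL_ratioE].
Qed.

Lemma eta_chi2E :
  eta_chi2 pi K = sup_or0 [set (chi2_ratio nu)%:E | nu in admissible].
Proof.
rewrite /eta_chi2; congr sup_or0; apply/seteqP; split=> y [nu].
  by move=> [dn /(chi2_gt0_lty nu hpi)[ac np]] <-; exists nu; rewrite ?chi2_ratioE.
move=> adm <-; have [dn ac np] := adm.
by exists nu; [split=> //; apply/chi2_gt0_lty|rewrite chi2_ratioE].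
Qed.

(** Quotient of the two instances of [klr_quadratic], for [nu] and for its push-forward; the factors
    [2] cancel. *)
Lemma ratio_bounds nu (e : R) : admissible nu -> 0 < e < 1 ->
  (forall x, `|nu x - pi x| <= e * pi x) ->
  (1 - e) * chi2_ratio nu <= (1 + e) * kl_ratio nu /\
  (1 - e) * kl_ratio nu <= (1 + e) * chi2_ratio nu.
Proof.
move=> [dn ac np] e01 ne.
have k0 := klr_gt0 dn hpi ac np; have c0 := chi2r_gt0 hpi ac np.
have /andP[] := klr_quadratic dn hpi e01 ne.
have /andP[] := klr_quadratic (push_dist hK dn) (push_dist hK hpi) e01 (push_close hK ne).
have C0 := chi2r_ge0 (push nu K) (push pi K).
have K0 := klr_ge0 (push_dist hK dn) (push_dist hK hpi) (push_abs_cont hK hpi ac).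
move: e01 => /andP[e0 e1].
have a0 : 0 < 2 * (1 + e) by lra.
have b0 : 0 < 2 * (1 - e) by lra.
rewrite /kl_ratio /chi2_ratio !ler_pdivrMr// !ler_pdivlMr//.
move: k0 c0 C0 K0; set k := klr nu pi; set c := chi2r nu pi.
set K' := klr _ _; set C' := chi2r _ _ => k0 c0 C0 K0 h1 h2 h3 h4.
rewrite !mulrA !ler_pdivrMr// ![_ / _ * _]mulrAC !ler_pdivlMr//; split; nra.
Qed.

(* The chi-squared ratio is constant along the segment from [pi] to [nu], and
   the KL ratio tends to it at [pi]. *)
Lemma chi2_ratio_approx nu (a : R) : admissible nu -> a < chi2_ratio nu ->
  exists2 mu, admissible mu & a <= kl_ratio mu.
Proof.
move=> adm ar; have [a0|a0] := ltP a 0.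
  by exists nu => //; exact: le_trans (ltW a0) (kl_ratio_ge0 adm).
have /exists_factor_gap[e /andP[e0 e1] ee] : 0 <= a < chi2_ratio nu by rewrite a0.
have [dn ac np] := adm; have [x0 px0 nx0] := neq_support hpi ac np.
have [n0 n1] := dn; have [p0 p1] := hpi; move/abs_contP: (ac) => acP.
(* The summand [1] gives [M >= 1], so that [t = e / M] is below [1] and [mu] is a convex combination
   of [pi] and [nu], within relative distance [e] of [pi]. *)
pose M := 1 + rel_dist nu pi.
have M1 : 1 <= M by rewrite lerDl rel_dist_ge0.
have Mx x : `|nu x - pi x| <= M * pi x.
  by apply: le_trans (ler_rel_dist x hpi ac) _; rewrite ler_wpM2r// lerDr.
pose t := e / M.
have M0 : 0 < M by lra.
have t0 : 0 < t by rewrite divr_gt0.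
have tM : t * M = e by rewrite divfK// gt_eqF.
have t1 : t < 1 by nra.
pose mu x := pi x + t * (nu x - pi x).
have muB x : mu x - pi x = t * (nu x - pi x) by rewrite /mu addrC addKr.
have pmuB y : push mu K y - push pi K y = t * (push nu K y - push pi K y).
  rewrite /push -!sumrB mulr_sumr; apply: eq_bigr => x _.
  by rewrite -!mulrBl muB mulrA.
have adm' : admissible mu.
  split.
  - split=> [x|]; first by have := n0 x; have := p0 x; rewrite /mu; nra.
    by rewrite /mu big_split/= -mulr_sumr sumrB n1 p1 subrr mulr0 addr0.
  - by apply/abs_contP => x px; rewrite /mu acP// px subrr mulr0 addr0.
  - move=> /(congr1 (fun f => f x0)) /eqP; rewrite -subr_eq0 muB mulf_eq0 subr_eq0.
    by rewrite (negbTE nx0) gt_eqF.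
have muC x : `|mu x - pi x| <= e * pi x.
  by rewrite muB normrM (gtr0_norm t0) -tM -mulrA ler_pM2l.
(* Used on both [X] and [Y]; the two factors [t ^+ 2] then cancel in the ratio. *)
have scale (Z : finType) (f g q : Z -> R) : (forall z, f z - q z = t * (g z - q z)) ->
    chi2r f q = t ^+ 2 * chi2r g q.
  move=> fg; rewrite /chi2r mulr_sumr; apply: eq_bigr => z _.
  by rewrite fg exprMn -mulrA.
have rE : chi2_ratio mu = chi2_ratio nu.
  rewrite /chi2_ratio (scale _ _ _ _ muB) (scale _ _ _ _ pmuB).
  by rewrite -mulf_div divff ?mul1r// expf_neq0// gt_eqF.
exists mu => //.
have [|+ _] := ratio_bounds adm' _ muC; first by rewrite e0.
rewrite rE => h.
have e2 : 0 < 1 + e by lra.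
by rewrite -(ler_pM2l e2); lra.
Qed.

End contraction.

(** * The dichotomy *)

Theorem lemma25 (R : realType) (X Y : finType) (pi : X -> R) (K : X -> Y -> R)
  (hpi : is_dist pi) (hK : is_kernel K) :
  eta_KL pi K = eta_chi2 pi K
  \/ (exists nu : X -> R,
        [/\ is_dist nu,
            (0 < KL nu pi < +oo)%E
          & eta_KL pi K = (KL (push nu K) (push pi K) / KL nu pi)%E]).
Proof.
rewrite eta_KLE// eta_chi2E//.
have [adm0|/set0P[nu1 adm1]] := eqVneq (admissible pi) set0.
  by left; rewrite adm0 !image_set0.
have sup0E (f : (X -> R) -> \bar R) :
    sup_or0 [set f nu | nu in admissible pi] = ereal_sup [set f nu | nu in admissible pi].
  rewrite /sup_or0 ifF//; apply/negP => /eqP/seteqP[/(_ (f nu1)) + _].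
  by apply; exists nu1.
rewrite !sup0E; set A := ereal_sup _; set B := ereal_sup _.
(* If some chi-squared ratio exceeded [A], a KL ratio would reach the midpoint between [A] and it,
   hence exceed [A]. *)
have BA : (B <= A)%E.
  apply: ge_ereal_sup => _ [nu adm <-]; rewrite leNgt; apply/negP => Ar.
  have A0 : (0 <= A)%E.
    apply: le_trans (ereal_sup_ubound _); last by exists nu1.
    by rewrite lee_fin kl_ratio_ge0.
  case EA : A Ar A0 => [a| |]//; rewrite lte_fin lee_fin => ar a0.
  have [mu admu] := chi2_ratio_approx hpi hK adm (a := (a + chi2_ratio pi K nu) / 2) ltac:(lra).
  have : ((kl_ratio pi K mu)%:E <= A)%E by apply: ereal_sup_ubound; exists mu.
  by rewrite EA lee_fin; lra.
have [AB|BltA] := leP A B; first by left; apply/eqP; rewrite eq_le AB.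
right.
have [_ [nu0 adm0 <-] Bnu0] : exists2 y, [set (kl_ratio pi K nu)%:E | nu in admissible pi] y & (B < y)%E.
  exact: ereal_sup_gt.
have ubB nu : admissible pi nu -> ((chi2_ratio pi K nu)%:E <= B)%E.
  by move=> adm; apply: ereal_sup_ubound; exists nu.
(* [B] is finite: it lies above a real ratio and strictly below another. *)
have [s EB] : exists s, B = s%:E.
  have := ubB _ adm1; case: (B) Bnu0 => [s| |]//; by exists s.
rewrite EB in Bnu0 ubB.
have s0 : 0 <= s.
  by rewrite -lee_fin; apply: le_trans (ubB _ adm1); rewrite lee_fin divr_ge0// chi2r_ge0.
(* A threshold strictly between [B] and the KL ratio of [nu0]: the gap above [s] yields the radius
   [e], and the gap below forces [nu0] into [far]. *)
rewrite lte_fin in Bnu0; set c := (s + kl_ratio pi K nu0) / 2.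
have /exists_factor_gap[e e01 sce] : 0 <= s < c by rewrite /c; lra.
have /andP[e0 e1] := e01.
pose far := [set nu | [/\ is_dist nu, abs_cont nu pi & e <= rel_dist nu pi]].
have closeP nu : admissible pi nu -> ~ far nu -> kl_ratio pi K nu <= c.
  move=> adm nf; have [dn ac np] := adm.
  have ne x : `|nu x - pi x| <= e * pi x.
    apply: le_trans (ler_rel_dist x hpi ac) _; rewrite ler_wpM2r ?hpi.1// leNgt.
    by apply/negP => /ltW ex; apply: nf; split.
  (* The chain is [(1 - e) * kl_ratio <= (1 + e) * chi2_ratio <= (1 + e) * s <= (1 - e) * c]. *)
  have [_] := ratio_bounds hpi hK adm e01 ne.
  have := ubB _ adm; rewrite lee_fin => rs h.
  have e2 : 0 < 1 - e by lra.
  rewrite -(ler_pM2l e2); nra.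
have far0 : far nu0.
  by apply: contrapT => /(closeP _ adm0); rewrite /c; lra.
have [nu fnu numax] := klr_max_ratio hpi hK e0 (ex_intro _ _ far0).
have adm : admissible pi nu.
  have [dn ac nf] := fnu; split=> // np; move: nf.
  by rewrite np rel_dist_self leNgt e0.
have [dn ac np] := adm.
exists nu; split=> //; first by apply/KL_gt0_lty.
rewrite KL_ratioE//; apply/eqP; rewrite eq_le; apply/andP; split; last first.
  by apply: ereal_sup_ubound; exists nu.
apply: ge_ereal_sup => _ [mu admu <-]; rewrite lee_fin.
(* Outside [far] the ratio is at most [c], below that of [nu0], which the maximizer dominates. *)
have [fmu|/(closeP _ admu) mc] := pselect (far mu); first exact: numax.
by have := numax _ far0; rewrite -!/(kl_ratio _ _ _) /c in mc *; lra.
Qed.
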